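(* Let $y$ be the exact solution of the ODE $\dot y=f(y,t)$ on $(0,T]$, $y(0)=y_0$, let $Y^K$ be the final iterate ($K\ge1$) of the SDC-equivalent finite element method with quadrature rule $R\in\{LHR,RHR\}$, let $e=y-Y^K$, and let $\phi$ be the solution of the adjoint problem with data $\psi\in L^2([0,T];\mathbb R^d)$, $\psi_T\in\mathbb R^d$ (all as defined in the context). Then $$\langle e,\psi\rangle_{[0,T]}+(e(T),\psi_T)=E_D+E_M+E_K,$$ where $$E_D=\sum_{n=0}^{N-1}\sum_{m=0}^{M-1}\Big[\langle S_nf^{K-1}-\dot Y^K,\ \phi-\pi_{n,m}\phi\rangle_{I_{n,m}}+\langle f(Y^K,t)-f(Y^{K-1},t),\ \phi-\pi_{n,m}\phi\rangle_{R,I_{n,m}}\Big],$$ $$E_M=\sum_{n=0}^{N-1}\sum_{m=0}^{M-1}\langle f(Y^K,t)-S_nf^K,\ \phi\rangle_{I_{n,m}},$$ $$E_K=\sum_{n=0}^{N-1}\sum_{m=0}^{M-1}\Big[\langle f(Y^{K-1},t)-f(Y^K,t),\ \phi\rangle_{R,I_{n,m}}+\langle S_nf^K-S_nf^{K-1},\ \phi\rangle_{I_{n,m}}\Big],$$ and $\pi_{n,m}$ is a nodal projection operator onto $\mathcal P^{q-1}(I_{n,m})$.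
   Context: The ODE is $\dot y(t)=f(y(t),t)$, $t\in(0,T]$, $y(0)=y_0\in\mathbb R^d$, with $f:\mathbb R^d\times\mathbb R\to\mathbb R^d$ continuous and continuously differentiable in its first argument. Grid: $0=t_0<t_1<\dots<t_N=T$, $I_n=[t_n,t_{n+1}]$. Each $I_n$ is subdivided by $M+1$ subnodes $t_n=t_{n,0}<t_{n,1}<\dots<t_{n,M}=t_{n+1}$ (the Gauss-Lobatto nodes of $I_n$), with $I_{n,m}=[t_{n,m},t_{n,m+1}]$ and $\Delta t_{n,m}=t_{n,m+1}-t_{n,m}$. Spaces: for $q\ge1$, $\mathcal P^{q}(I_{n,m})$ is the space of ($\mathbb R^d$-valued) polynomials of degree at most $q$ on $I_{n,m}$, and $\mathcal C^q=\{w\in C^0([0,T];\mathbb R^d): w|_{I_{n,m}}\in\mathcal P^q(I_{n,m}),\ 0\le n\le N-1,\ 0\le m\le M-1\}$. Inner products: $(\cdot,\cdot)$ is the Euclidean inner product on $\mathbb R^d$ and $\langle g,v\rangle_{\omega}=\int_{\omega}(g,v)\,dt$ for an interval $\omega$. $\langle g,v\rangle_{R,I_{n,m}}$ is the approximation of $\langle g,v\rangle_{I_{n,m}}$ by the left-hand rule, $\langle g,v\rangle_{LHR,I_{n,m}}=\Delta t_{n,m}(g(t_{n,m}),v(t_{n,m}))$, or the right-hand rule, $\langle g,v\rangle_{RHR,I_{n,m}}=\Delta t_{n,m}(g(t_{n,m+1}),v(t_{n,m+1}))$. SDC-equivalent finite element method: given the iterate $Y^{k}\in\mathcal C^q$,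 the next iterate is $Y^{k+1}\in\mathcal C^q$ with $Y^{k+1}(0)=y_0$ and, for $n=0,\dots,N-1$, $m=0,\dots,M-1$, $$\langle \dot Y^{k+1}, v\rangle_{I_{n,m}} = \langle f(Y^{k+1},t)-f(Y^k,t), v\rangle_{R,I_{n,m}} + \langle S_n f^k, v\rangle_{I_{n,m}}\qquad \text{for all } v\in\mathcal P^{q-1}(I_{n,m}),$$ where $S_nf^k$ is the ($\mathbb R^d$-valued) polynomial interpolant of degree at most $M$ on $I_n$ of the values $f(Y^k(t_{n,m}),t_{n,m})$ at the nodes $t_{n,m}$, $m=0,\dots,M$. $Y^{K-1}$ and $Y^K$ are the last two iterates. Adjoint problem: $-\dot\phi=\overline{H_{y,Y^K}}^{\,T}\phi+\psi$ for $T>t\ge0$, $\phi(T)=\psi_T$, where $\overline{H_{y,Y^K}}(t)=\int_0^1\frac{\partial f}{\partial y}(z,t)\,ds$ with $z=s\,y(t)+(1-s)\,Y^K(t)$. Nodal projection: $\pi_{n,m}$ maps a function on $I_{n,m}$ to the polynomial in $\mathcal P^{q-1}(I_{n,m})$ that interpolates it at a fixed set of $q$ distinct nodes of $I_{n,m}$. *)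

(* Defs.v *)
From HB Require Import structures.
From mathcomp Require Import all_boot all_order all_algebra.
From mathcomp Require Import all_classical all_reals all_analysis.

Set Implicit Arguments.
Unset Strict Implicit.
Unset Printing Implicit Defensive.

Import Order.TTheory GRing.Theory Num.Theory.
Import numFieldNormedType.Exports.

Local Open Scope classical_set_scope.
Local Open Scope ring_scope.

(* Vectors of R^d are rows 'rV[R]_d, and functions on a compact interval are
   total functions on R of which only the values on that interval matter.     *)

Definition dotv (R : realType) (d : nat) (u v : 'rV[R]_d) : R :=
  \sum_(i < d) u 0 i * v 0 i.

Definition ip (R : realType) (d : nat) (a b : R) (g v : R -> 'rV[R]_d) : R :=
  \int[@lebesgue_measure R]_(t in `[a, b]) dotv (g t) (v t).

Inductive quad_rule := LHR | RHR.

Definition quad_node (R : realType) (Q : quad_rule) (a b : R) : R :=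
  match Q with LHR => a | RHR => b end.

Definition qip (R : realType) (d : nat) (Q : quad_rule) (a b : R)
    (g v : R -> 'rV[R]_d) : R :=
  (b - a) * dotv (g (quad_node Q a b)) (v (quad_node Q a b)).

(* R^d-valued polynomials; "degree at most k" is encoded as size <= k.+1.     *)

Definition vpoly_size_le (R : realType) (d r : nat) (p : 'rV[{poly R}]_d) :
    Prop :=
  forall i : 'I_d, (size (p ord0 i) <= r)%N.

Definition vhorner (R : realType) (d : nat) (p : 'rV[{poly R}]_d) (t : R) :
    'rV[R]_d :=
  \row_i (p 0 i).[t].

Definition lagrange_poly (R : realType) (r : nat) (x v : nat -> R) : {poly R} :=
  \sum_(i < r) v i *:
    \prod_(j < r | j != i) ((x i - x j)^-1 *: ('X - (x j)%:P)).

(* Polynomial of degree at most r.-1 interpolating g at x 0, ..., x r.-1.     *)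
Definition interp_poly (R : realType) (d r : nat) (x : nat -> R)
    (g : R -> 'rV[R]_d) : 'rV[{poly R}]_d :=
  \row_i lagrange_poly r x (fun k => g (x k) 0 i).

Definition interp (R : realType) (d r : nat) (x : nat -> R)
    (g : R -> 'rV[R]_d) : R -> 'rV[R]_d :=
  vhorner (interp_poly r x g).

Lemma size_interp_poly (R : realType) (d r : nat) (x : nat -> R)
    (g : R -> 'rV[R]_d) : vpoly_size_le r (interp_poly r x g).
Proof.
move=> l; rewrite mxE (leq_trans (size_sum _ _ _)) //.
apply/bigmax_leqP => i _; rewrite (leq_trans (size_scale_leq _ _)) //.
rewrite scaler_prod (leq_trans (size_scale_leq _ _)) //.
rewrite -big_filter size_prod_XsubC size_filter -sum1_count sum1_card.
by rewrite cardC1 card_ord prednK // (leq_ltn_trans _ (ltn_ord i)).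
Qed.

Lemma interp_node (R : realType) (d r : nat) (x : nat -> R)
    (g : R -> 'rV[R]_d) (k : nat) :
  (forall i j, (i < r)%N -> (j < r)%N -> x i = x j -> i = j) ->
  (k < r)%N -> interp r x g (x k) = g (x k).
Proof.
move=> xI kr; apply/rowP => l; rewrite /interp /vhorner !mxE.
rewrite horner_sum (bigD1 (Ordinal kr)) //= [X in _ + X]big1 ?addr0.
  rewrite hornerZ horner_prod [X in _ * X]big1 ?mulr1 // => j jk.
  rewrite hornerZ hornerXsubC mulVf // subr_eq0.
  by apply: contra jk => /eqP/xI e; apply/eqP/val_inj; rewrite /= -e.
move=> i ik; rewrite hornerZ horner_prod (bigD1 (Ordinal kr)) 1?eq_sym //=.
by rewrite hornerZ hornerXsubC subrr mulr0 mul0r mulr0.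
Qed.

(* Rodrigues' formula. *)
Definition legendre (R : realType) (M : nat) : {poly R} :=
  (2 ^+ M * M`!%:R)^-1 *: (('X^2 - 1) ^+ M)^`(M).

(* Its M.+1 roots, all in [-1, 1], are the Gauss-Lobatto nodes of [-1, 1].    *)
Definition gauss_lobatto_poly (R : realType) (M : nat) : {poly R} :=
  ('X^2 - 1) * (legendre R M)^`().

Definition grid (R : realType) (T : R) (N : nat) (t : nat -> R) : Prop :=
  [/\ t 0%N = 0, t N = T & forall n, (n < N)%N -> t n < t n.+1].

(* tau n m is the subnode t_{n,m}. Since gauss_lobatto_poly M has degree M.+1,
   the M.+1 increasing subnodes are exhausted by its (rescaled) roots.        *)
Definition gauss_lobatto_subgrid (R : realType) (N M : nat) (t : nat -> R)
    (tau : nat -> nat -> R) : Prop :=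
  forall n, (n < N)%N ->
  [/\ tau n 0%N = t n, tau n M = t n.+1,
      forall m, (m < M)%N -> tau n m < tau n m.+1 &
      forall m, (m <= M)%N ->
        root (gauss_lobatto_poly R M)
          (2 * (tau n m - t n) / (t n.+1 - t n) - 1)].

Definition fe_space (R : realType) (d : nat) (T : R) (N M q : nat)
    (tau : nat -> nat -> R) (w : R -> 'rV[R]_d) : Prop :=
  {within `[0, T], continuous w} /\
  forall n m, (n < N)%N -> (m < M)%N ->
    exists2 p : 'rV[{poly R}]_d, vpoly_size_le q.+1 p &
      {in `[tau n m, tau n m.+1], w =1 vhorner p}.

Definition along (R : realType) (d : nat) (f : 'rV[R]_d * R -> 'rV[R]_d)
    (w : R -> 'rV[R]_d) : R -> 'rV[R]_d :=
  fun t => f (w t, t).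

(* S_n f^k, with w the iterate Y^k. *)
Definition sdc_interp (R : realType) (d M : nat) (tau : nat -> nat -> R)
    (f : 'rV[R]_d * R -> 'rV[R]_d) (n : nat) (w : R -> 'rV[R]_d) :
    R -> 'rV[R]_d :=
  interp M.+1 (tau n) (along f w).

(* derive1 W is a junk value at the subnodes where the polynomial pieces of W do
   not match to first order: a finite set, irrelevant under the integral.     *)
Definition sdc_step (R : realType) (d : nat) (N M q : nat)
    (tau : nat -> nat -> R) (Q : quad_rule) (f : 'rV[R]_d * R -> 'rV[R]_d)
    (y0 : 'rV[R]_d) (w W : R -> 'rV[R]_d) : Prop :=
  W 0 = y0 /\
  forall n m, (n < N)%N -> (m < M)%N ->
  forall v : 'rV[{poly R}]_d, vpoly_size_le q v ->
    ip (tau n m) (tau n m.+1) (derive1 W) (vhorner v) =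
      qip Q (tau n m) (tau n m.+1) (along f W \- along f w) (vhorner v)
      + ip (tau n m) (tau n m.+1) (sdc_interp M tau f n w) (vhorner v).

(* The derivative is taken within [0, T], hence is one-sided at T. *)
Definition ode_solution (R : realType) (d : nat)
    (f : 'rV[R]_d * R -> 'rV[R]_d) (T : R) (y0 : 'rV[R]_d)
    (y : R -> 'rV[R]_d) : Prop :=
  [/\ {within `[0, T], continuous y}, y 0 = y0 &
      forall t, t \in `]0, T] ->
        (s - t)^-1 *: (y s - y t) @[s --> within `[0, T] t^'] --> f (y t, t)].

(* jacobian acts on row vectors ('d g z v = v *m 'J g z): 'J is the transpose
   of the matrix (d f_i / d z_j)_(i, j).                                      *)
Definition dfdy (R : realType) (d : nat) (f : 'rV[R]_d * R -> 'rV[R]_d)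
    (z : 'rV[R]_d) (t : R) : 'M[R]_d :=
  ('J (fun z' => f (z', t)) z)^T.

Definition C1_in_fst (R : realType) (d : nat) (f : 'rV[R]_d * R -> 'rV[R]_d) :
    Prop :=
  forall t : R, (forall z, differentiable (fun z' => f (z', t)) z) /\
                continuous (fun z => dfdy f z t).

Definition avg_jacobian (R : realType) (d : nat)
    (f : 'rV[R]_d * R -> 'rV[R]_d) (y w : R -> 'rV[R]_d) (t : R) : 'M[R]_d :=
  \matrix_(i, j) \int[@lebesgue_measure R]_(s in `[0, 1])
    dfdy f (s *: y t + (1 - s) *: w t) t i j.

Definition L2_fun (R : realType) (d : nat) (a b : R) (g : R -> 'rV[R]_d) :
    Prop :=
  forall i : 'I_d, measurable_fun `[a, b] (fun t => g t 0 i) /\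
    (@lebesgue_measure R).-integrable `[a, b] (fun t => ((g t 0 i) ^+ 2)%:E).

(* Absolute continuity, as being an indefinite Lebesgue integral. *)
Definition abs_continuous (R : realType) (d : nat) (a b : R)
    (g : R -> 'rV[R]_d) : Prop :=
  forall i : 'I_d, exists2 h : R -> R,
    (@lebesgue_measure R).-integrable `[a, b] (EFin \o h) &
    {in `[a, b], forall t,
      g t 0 i = g a 0 i + \int[@lebesgue_measure R]_(s in `[a, t]) h s}.

(* As psi is only L^2, phi is a Caratheodory solution. H^T phi is a product of
   the matrix H^T with a column, i.e. phi t *m H t in terms of rows.          *)
Definition adjoint_solution (R : realType) (d : nat) (T : R)
    (H : R -> 'M[R]_d) (psi : R -> 'rV[R]_d) (psiT : 'rV[R]_d)
    (phi : R -> 'rV[R]_d) : Prop :=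
  [/\ abs_continuous 0 T phi,
      {ae @lebesgue_measure R, forall t, t \in `[0, T] ->
         derivable phi t 1 /\ - derive1 phi t = phi t *m H t + psi t} &
      phi T = psiT].

Definition projection_nodes (R : realType) (N M q : nat)
    (tau : nat -> nat -> R) (x : nat -> nat -> nat -> R) : Prop :=
  forall n m, (n < N)%N -> (m < M)%N ->
    (forall i, (i < q)%N -> x n m i \in `[tau n m, tau n m.+1]) /\
    (forall i j, (i < q)%N -> (j < q)%N -> x n m i = x n m j -> i = j).

(* Main.v *)
(** The error e = y - Y^K and the dual solution phi are both absolutely
    continuous, so on a cell [a, b] integration by parts gives
    int (e', phi) + int (e, phi') = [(e, phi)]_a^b.
    There e' = f(y) - (Y^K)', phi' = - H^T phi - psi almost everywhere, and
    H e = f(y) - f(Y^K) by the fundamental theorem of calculus along the segment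
    from Y^K(t) to y(t); hence
    int (e, psi) + [(e, phi)]_a^b = int (f(Y^K) - (Y^K)', phi).
    The boundary terms telescope and e(0) = 0.  Inserting S_n f^K, S_n f^{K-1}
    and the quadrature terms, and subtracting the equation of the last SDC step
    tested with v = pi phi, splits the right-hand side into the three terms.

    Since f is C^1 in y only for each fixed t, nothing is known about the
    regularity of H in t and phi is merely absolutely continuous: integration by
    parts is obtained from Fubini's theorem, and phi' from Lebesgue
    differentiation. *)

Require Import Defs.
From HB Require Import structures.
From mathcomp Require Import all_boot all_order all_algebra.
From mathcomp Require Import all_classical all_reals all_analysis.
From mathcomp Require Import measurable_realfun ring lra.

Set Implicit Arguments.
Unset Strict Implicit.
Unset Printing Implicit Defensive.

Import Order.TTheory GRing.Theory Num.Theory.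
Import numFieldNormedType.Exports.

Local Open Scope classical_set_scope.
Local Open Scope ring_scope.

Local Notation mu := (@lebesgue_measure _).

(** * Integration by parts for indefinite Lebesgue integrals *)

Lemma integrable_EFinD d (T : measurableType d) (R : realType)
    (m : {measure set T -> \bar R}) (D : set T) (u v : T -> R) :
  measurable D -> m.-integrable D (EFin \o u) -> m.-integrable D (EFin \o v) ->
  m.-integrable D (EFin \o (fun t => u t + v t)).
Proof. by move=> mD iu iv; exact: (integrableD mD iu iv). Qed.

Lemma integrable_EFinB d (T : measurableType d) (R : realType)
    (m : {measure set T -> \bar R}) (D : set T) (u v : T -> R) :
  measurable D -> m.-integrable D (EFin \o u) -> m.-integrable D (EFin \o v) ->
  m.-integrable D (EFin \o (fun t => u t - v t)).
Proof. by move=> mD iu iv; exact: (integrableB mD iu iv). Qed.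

Lemma integral_itv_obndc_sub (R : realType) (a b s : R) (g : R -> R) :
  (@lebesgue_measure R).-integrable `[a, b] (EFin \o g) -> s \in `[a, b] ->
  (\int[@lebesgue_measure R]_(t in `]s, b]) (g t)%:E =
  (\int[@lebesgue_measure R]_(t in `[a, b]) g t -
   \int[@lebesgue_measure R]_(t in `[a, s]) g t)%:E)%E.
Proof.
rewrite in_itv /= => ig /andP[as_ sb].
rewrite Rintegral_itvB ?bnd_simp// /Rintegral fineK//.
apply: integrable_fin_num => //; apply: integrableS ig => //.
by apply: subset_itvr; rewrite bnd_simp.
Qed.

Lemma integrable_patch_itv (R : realType) (h : R -> R) (a b : R) :
  mu.-integrable `[a, b] (EFin \o h) ->
  mu.-integrable setT (EFin \o (h \_ `[a, b])).
Proof.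
move=> ih; rewrite -restrict_EFin.
exact: (integrable_mkcond (mu := mu) (D := `[a, b]) _ (measurable_itv _)).1.
Qed.

(** The iterated integral of [|k|] is at most the product of the L^1 norms of [f] and [g], so [k] is
    integrable on the product space. *)
Lemma dominated_Fubini (d1 d2 : measure_display)
    (T1 : measurableType d1) (T2 : measurableType d2) (R : realType)
    (m1 : {sigma_finite_measure set T1 -> \bar R})
    (m2 : {sigma_finite_measure set T2 -> \bar R})
    (f : T1 -> \bar R) (g : T2 -> \bar R) (k : T1 * T2 -> \bar R) :
  m1.-integrable setT f -> m2.-integrable setT g -> measurable_fun setT k ->
  (forall z, (`|k z| <= `|f z.1| * `|g z.2|)%E) ->
  (\int[m1]_s \int[m2]_t k (s, t) = \int[m2]_t \int[m1]_s k (s, t))%E.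
Proof.
move=> /integrableP[mf foo] /integrableP[mg goo] mk kfg.
have maf : measurable_fun setT (abse \o f) by exact: measurableT_comp.
have mag : measurable_fun setT (abse \o g) by exact: measurableT_comp.
(* Finiteness makes this integral a real constant, which can be moved across the integral in [s] and
   keeps the final product finite. *)
have Ig : (\int[m2]_t `|g t| \is a fin_num)%E.
  by rewrite ge0_fin_numE//; exact: integral_ge0.
apply: Fubini; apply/integrable12ltyP => //.
apply: (@le_lt_trans _ _ (\int[m1]_s ((\int[m2]_t `|g t|) * `|f s|))%E).
  apply: ge0_le_integral => //.
  - by move=> s _; exact: integral_ge0.
  - apply: (measurable_fun_fubini_tonelli_F (abse \o k)) => //.
      exact: measurableT_comp.
    by move=> z; exact: abse_ge0.
  - by rewrite -(fineK Ig); exact: measurable_funeM.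
  - move=> s _; rewrite muleC -ge0_integralZl//.
    apply: ge0_le_integral => //.
    + by apply: measurableT_comp => //;
        exact: measurableT_comp mk (measurable_pair1 _).
    + exact: emeasurable_funM.
rewrite ge0_integralZl//; last exact: integral_ge0.
by apply: lte_mul_pinfty => //; exact: integral_ge0.
Qed.

(** On a compact interval [u] is measurable and bounded, and a bounded measurable factor preserves
    integrability. *)
Lemma integrable_continuousM (R : realType) (a b : R) (u v : R -> R) :
  {within `[a, b], continuous u} ->
  mu.-integrable `[a, b] (EFin \o v) ->
  mu.-integrable `[a, b] (EFin \o (u \* v)).
Proof.
move=> cu iv.
have mab : measurable (`[a, b] : set (measurableTypeR R))
  by exact: measurable_itv.
rewrite (_ : _ \o _ = (EFin \o u) \* (EFin \o v))%E; last first.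
  by apply/funext => t /=; rewrite EFinM.
apply: integrableMr => //; first exact: subspace_continuous_measurable_fun.
have /compact_bounded[M [_ Mu]] :=
  continuous_compact cu (@segment_compact _ a b).
by exists M; split; rewrite ?num_real // => ? ? ? ?; exact: Mu.
Qed.

(* Fubini for h(s) g(t) on the triangle s < t. *)
Lemma indefinite_integral_by_parts (R : realType) (a b : R) (h g : R -> R) :
  mu.-integrable `[a, b] (EFin \o h) -> mu.-integrable `[a, b] (EFin \o g) ->
  a <= b ->
  \int[mu]_(t in `[a, b]) ((\int[mu]_(s in `[a, t]) h s) * g t) +
  \int[mu]_(t in `[a, b]) (h t * (\int[mu]_(s in `[a, t]) g s)) =
  (\int[mu]_(s in `[a, b]) h s) * (\int[mu]_(s in `[a, b]) g s).
Proof.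
move=> ih ig ab.
pose P t := \int[mu]_(s in `[a, t]) h s.
pose G t := \int[mu]_(s in `[a, t]) g s.
rewrite -/(P b) -/(G b).
pose S := measurableTypeR R.
pose h0 : S -> R := h \_ `[a, b]; pose g0 : S -> R := g \_ `[a, b].
(* The kernel lives on the whole plane: [h] and [g] are extended by zero outside [[a, b]], and the
   indicator cuts out the triangle. *)
pose k (z : S * S) : \bar R :=
  (h0 z.1 * (g0 z.2 * \1_[set w : S * S | w.1 < w.2] z))%:E.
have ih0 : mu.-integrable setT (EFin \o h0).
  exact: integrable_patch_itv.
have ig0 : mu.-integrable setT (EFin \o g0).
  exact: integrable_patch_itv.
have mh0 : measurable_fun setT h0 by apply/measurable_EFinP;
  exact: (measurable_int mu).
have mg0 : measurable_fun setT g0 by apply/measurable_EFinP;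
  exact: (measurable_int mu).
have mlt : measurable [set w : S * S | w.1 < w.2].
  have := @measurable_fun_ltr _ _ R [set: S * S] fst snd measurable_fst measurable_snd.
  move=> /(_ measurableT [set true]); rewrite setTI; exact.
have mk : measurable_fun setT k.
  apply/measurable_EFinP; apply: measurable_funM.
    exact: measurableT_comp mh0 measurable_fst.
  apply: measurable_funM; first exact: measurableT_comp mg0 measurable_snd.
  exact: measurable_indic.
have kle z : (`|k z| <= `|(h0 z.1)%:E| * `|(g0 z.2)%:E|)%E.
  rewrite /k /= -EFinM lee_fin !normrM ler_wpM2l// ler_piMr//.
  by rewrite indicE; case: (_ \in _); rewrite ?normr1 ?normr0.
have := @dominated_Fubini _ _ _ _ _ (@lebesgue_measure R) (@lebesgue_measure R)
  _ _ _ ih0 ig0 mk kle.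
have ltE (s t : S) : ((s, t) \in [set w : S * S | w.1 < w.2]) = (s < t).
  by apply/idP/idP; rewrite inE.
(* For fixed [s] the variable [t] ranges over []s, b]], which leaves the increment of [G] from [s]
   to [b]. *)
have Ek1 s : (\int[mu]_t k (s, t) =
    (((fun s => h s * (G b - G s)) \_ `[a, b]) s)%:E)%E.
  rewrite patchE; case: ifPn => [|] sab; last first.
    under eq_integral do rewrite /k /h0 patchE (negbTE sab) mul0r.
    by rewrite integral0.
  transitivity (\int[mu]_t ((h s)%:E * ((EFin \o g) \_ `]s, b]) t))%E.
    apply: eq_integral => t _.
    (* Outside its set a patched function takes the default value [point], which is zero both in [R]
       and in [\bar R]. *)
    rewrite /k /h0 /g0 /= !patchE sab indicE ltE /= -![point]/(0 : R) -![point]/(0%E : \bar R).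
    have -> : (t \in `]s, b]%classic) = (t \in `[a, b]%classic) && (s < t).
      move: sab; rewrite !mem_setE !in_itv/= => /andP[as_ sb].
      by case: (ltP s t) => [st|ts];
        rewrite ?andbT ?andbF// (le_trans as_ (ltW st)).
    by case: (_ \in _); case: (s < t);
      rewrite /= ?mulr0 ?mulr1 ?mul0r ?mulr0 ?mule0 -?EFinM.
  rewrite integralZl//; last first.
    apply: (integrable_mkcond (mu := mu) (D := `]s, b]) _ (measurable_itv _)).1.
    apply: integrableS ig => //; apply: subset_itvr.
    by move: sab; rewrite mem_setE in_itv/= bnd_simp => /andP[].
  rewrite -integral_mkcond (integral_itv_obndc_sub ig) ?EFinM//.
  by move: sab; rewrite inE.
(* For fixed [t] the variable [s] ranges over [[a, t[]; adding the null point [t] gives [P t]. *)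
have Ek2 t : (\int[mu]_s k (s, t) =
    (((fun t => P t * g t) \_ `[a, b]) t)%:E)%E.
  rewrite patchE; case: ifPn => [|] tab; last first.
    under eq_integral do rewrite /k /g0 patchE (negbTE tab) mul0r mulr0.
    by rewrite integral0.
  have iht : mu.-integrable `[a, t] (EFin \o h).
    apply: integrableS ih => //; apply: subset_itvl.
    by move: tab; rewrite mem_setE in_itv/= bnd_simp => /andP[].
  have iht' : mu.-integrable `[a, t[ (EFin \o h).
    by apply: integrableS iht => //; apply: subset_itvl; rewrite bnd_simp.
  transitivity (\int[mu]_s ((g t)%:E * ((EFin \o h) \_ `[a, t[) s))%E.
    apply: eq_integral => s _.
    rewrite /k /h0 /g0 /= !patchE tab indicE ltE /= -![point]/(0 : R) -![point]/(0%E : \bar R).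
    have -> : (s \in `[a, t[%classic) = (s \in `[a, b]%classic) && (s < t).
      move: tab; rewrite !mem_setE !in_itv/= => /andP[at_ tb].
      case: (ltP s t) => [st|ts]; rewrite ?andbT ?andbF//.
      by rewrite (ltW (lt_le_trans st tb)) andbT.
    by case: (_ \in _); case: (s < t);
      rewrite /= ?mulr0 ?mulr1 ?mul0r ?mulr0 ?mule0 -?EFinM // mulrC.
  rewrite integralZl//; last first.
    exact: (integrable_mkcond (mu := mu) (D := `[a, t[) _ (measurable_itv _)).1.
  rewrite -integral_mkcond integral_itv_bndo_bndc//;
    last exact: measurable_int iht'.
  by rewrite mulrC EFinM /P /Rintegral fineK//; exact: integrable_fin_num iht.
have cG : {within `[a, b], continuous G}
  by exact: parameterized_integral_continuous.
under eq_integral do rewrite Ek1.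
under [X in _ = X -> _]eq_integral do rewrite Ek2.
(* Fubini now reads: the integral of [P * g] is that of [h * (G b - G)]. Adding the integral of
   [h * G] leaves [h] times the constant [G b]. *)
move/(congr1 fine); rewrite -!/(Rintegral _ _ _) -!Rintegral_mkcond => <-.
have ihM u : {within `[a, b], continuous u} ->
    mu.-integrable `[a, b] (EFin \o (fun s => h s * u s)).
  move=> cu; rewrite (_ : _ \o _ = EFin \o (u \* h)).
    exact: integrable_continuousM.
  by apply/funext => s /=; rewrite mulrC.
rewrite -RintegralD//; [|apply: ihM|exact: ihM].
  under eq_Rintegral do rewrite -mulrDr subrK.
  by rewrite RintegralZr.
by apply: within_continuousB => // s; exact: cvg_cst.
Qed.

Lemma Rintegral_sum d (T : measurableType d) (R : realType)
    (m : {measure set T -> \bar R}) (D : set T) (I : Type) (r : seq I)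
    (F : I -> T -> R) :
  measurable D -> (forall i, m.-integrable D (EFin \o F i)) ->
  \int[m]_(t in D) (\sum_(i <- r) F i t) = \sum_(i <- r) \int[m]_(t in D) F i t.
Proof.
move=> mD iF; elim: r => [|i r IH].
  under eq_Rintegral do rewrite big_nil.
  by rewrite big_nil Rintegral_cst// mul0r.
under eq_Rintegral do rewrite big_cons.
rewrite big_cons -IH RintegralD//.
rewrite (_ : _ \o _ = fun t => (\sum_(j <- r) (F j t)%:E)%E).
  by apply: integrable_sum => // i0 _; exact: iF.
by apply/funext => t /=; rewrite sumEFin.
Qed.

(** Each function is split into its value at [a] and an indefinite integral. The product of the two
    integrals is the triangle identity, and the other terms are constants times integrals of [u']
    and [v']. *)
Lemma indefinite_integral_product (R : realType) (a b : R) (u v u' v' : R ->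
  R) :
  a <= b ->
  mu.-integrable `[a, b] (EFin \o u') -> mu.-integrable `[a, b] (EFin \o v') ->
  {in `[a, b], forall t, u t = u a + \int[mu]_(s in `[a, t]) u' s} ->
  {in `[a, b], forall t, v t = v a + \int[mu]_(s in `[a, t]) v' s} ->
  \int[mu]_(t in `[a, b]) (u t * v' t) + \int[mu]_(t in `[a, b]) (u' t * v t) =
  u b * v b - u a * v a.
Proof.
move=> ab iu iv uE vE.
have bb : b \in `[a, b] by rewrite in_itv/= lexx ab.
rewrite (uE b bb) (vE b bb).
have cU := parameterized_integral_continuous ab iu.
have cV := parameterized_integral_continuous ab iv.
rewrite /parameterized_integral in cU cV.
under eq_Rintegral => t tab.
  rewrite uE; last by rewrite inE in tab.
  rewrite mulrDl; over.
under [X in _ + X = _]eq_Rintegral => t tab.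
  rewrite vE; last by rewrite inE in tab.
  rewrite mulrDr [_ * v a]mulrC; over.
have iUv : mu.-integrable `[a, b]
    (EFin \o (fun t => (\int[mu]_(s in `[a, t]) u' s) * v' t)).
  exact: integrable_continuousM.
have iuV : mu.-integrable `[a, b]
    (EFin \o (fun t => u' t * (\int[mu]_(s in `[a, t]) v' s))).
  rewrite (_ : _ \o _ = EFin \o ((fun t =>
    \int[mu]_(s in `[a, t]) v' s) \* u')).
    exact: integrable_continuousM.
  by apply/funext => s /=; rewrite mulrC.
have icv : mu.-integrable `[a, b] (EFin \o (fun t => u a * v' t)).
  by apply: (integrable_continuousM (u := fun=> u a)) => // s; exact: cvg_cst.
have icu : mu.-integrable `[a, b] (EFin \o (fun t => v a * u' t)).
  by apply: (integrable_continuousM (u := fun=> v a)) => // s; exact: cvg_cst.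
rewrite !RintegralD// !RintegralZl//.
have := indefinite_integral_by_parts iu iv ab.
move=> /(canRL (addrK _)) ->; ring.
Qed.

(** * Passing between derivatives and indefinite integrals *)

Lemma FTC2_indefinite (R : realType) (a b : R) (F f : R -> R) :
  {within `[a, b], continuous F} -> {within `[a, b], continuous f} ->
  {in `]a, b[, forall t : R, is_derive t (1 : R) F (f t)} ->
  {in `[a, b], forall t, F t = F a + \int[mu]_(s in `[a, t]) f s}.
Proof.
move=> cF cf dF t; rewrite in_itv/= le_eqVlt => /andP[/predU1P[<- _|at_ tb]].
  by rewrite set_itv1 Rintegral_set1 addr0.
have sub : `[a, t] `<=` `[a, b] by apply: subset_itvl; rewrite bnd_simp.
have cFt : {within `[a, t], continuous F} by exact: continuous_subspaceW cF.
have cft : {within `[a, t], continuous f} by exact: continuous_subspaceW cf.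
have dt s : s \in `]a, t[ -> is_derive s (1 : R) F (f s).
  by move=> st; apply: dF; apply: subset_itvl st; rewrite bnd_simp.
rewrite /Rintegral (@continuous_FTC2 _ f F)//.
- by rewrite /= subrKC.
- have [_ ? ?] := (continuous_within_itvP _ at_).1 cFt.
  by split=> // s /dt [].
- by move=> s /dt [? <-]; rewrite derive1E.
Qed.

(** Lebesgue differentiation is applied to [h] extended by zero to the whole line; near an interior
    point, the indefinite integral of the extension is that of [h]. *)
Lemma indefinite_integral_ae_derive (R : realType) (a b : R) (u h : R -> R) :
  mu.-integrable `[a, b] (EFin \o h) ->
  {in `[a, b], forall t, u t = u a + \int[mu]_(s in `[a, t]) h s} ->
  {ae mu, forall t : R, t \in `]a, b[ -> is_derive t (1 : R) u (h t)}.
Proof.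
move=> ih uE.
have ih0 := integrable_patch_itv ih.
have iy y : mu.-integrable [set` Interval (BLeft a) (BRight y)]
    (EFin \o (h \_ `[a, b])).
  by apply: integrableS ih0.
have := FTC1 iy (open_integrable_locally openT ih0).
apply: filterS; first exact: (ae_filter_ringOfSetsType mu).
move=> t dF tab.
have tab' : t \in `[a, b] by apply: subset_itv_oo_cc tab.
have alt : (BLeft a < BRight t)%E.
  by move: tab; rewrite in_itv/= lte_fin => /andP[].
have [dFt dFE] := dF alt.
have {dF dFt dFE}dF : is_derive t (1 : R)
    (fun x => \int[mu]_(s in `[a, x]) (h \_ `[a, b]) s) (h t).
  by split => //; rewrite -derive1E dFE patchE mem_set.
have {}dF := is_deriveD (is_derive_cst (u a) t (1 : R)) dF.
rewrite add0r in dF; apply: near_eq_is_derive dF.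
have := near_in_itvoo tab; apply: filterS => s sab.
have sab' : s \in `[a, b] by apply: subset_itv_oo_cc sab.
rewrite [RHS]uE// fctE; congr (u a + _); apply: eq_Rintegral => r;
  rewrite inE/= => ras.
rewrite patchE mem_set//=; apply: subset_itvl ras.
by move: sab'; rewrite in_itv/= bnd_simp => /andP[].
Qed.

(** * The exact solution and the averaged Jacobian *)

Lemma ode_solution_is_derive (R : realType) (d : nat)
    (f : 'rV[R]_d * R -> 'rV[R]_d) (T : R) (y0 : 'rV[R]_d) (y : R -> 'rV[R]_d) :
  ode_solution f T y0 y ->
  {in `]0, T[, forall t : R, is_derive t (1 : R) y (f (y t, t))}.
Proof.
move=> [_ _ dy] t t0T.
have t0T' : t \in `]0, T] by apply: subset_itvl t0T; rewrite bnd_simp.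
have yt : h^-1 *: (y (h *: (1 : R) + t) - y t) @[h --> 0^'] --> f (y t, t).
  apply/cvgrPdist_lt => e e0.
  have /cvgrPdist_lt/(_ e e0) := dy t t0T'.
  move=> [r /= r0 yr].
  (* At an interior point the restriction to [[0, T]] is harmless: within [r'] of [t] every point
     belongs to []0, T[], so the limit is two-sided. *)
  have /(near_in_itvoo)[r' /= r'0 tr'] := t0T.
  exists (Num.min r r') => /=; first by rewrite lt_min r0.
  move=> h; rewrite /= sub0r normrN lt_min => /andP[hr hr'] h0.
  have /= := yr (h *: (1 : R) + t); rewrite ![_ *: (1 : R)]mulr1 addrK; apply.
  - by rewrite opprD addrCA subrr addr0 normrN.
  - by rewrite -subr_eq0 addrK.
  - apply: subset_itv_oo_cc; apply: tr'.
    by rewrite /= opprD addrCA subrr addr0 normrN.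
split; first by apply/cvg_ex; exists (f (y t, t)).
exact: cvg_lim.
Qed.

Lemma is_derive_row_coord (R : realType) (d : nat) (y : R -> 'rV[R]_d)
    (t : R) (l : 'rV[R]_d) (i : 'I_d) :
  is_derive t (1 : R) y l -> is_derive t (1 : R) (fun s => y s 0 i) (l 0 i).
Proof.
move=> [dy <-]; split; first exact: (derivable_mxP _ _ _).1.
by rewrite derive_mx// mxE.
Qed.

(** With [t] fixed, the [i]-th coordinate of [f] along the segment from [w t] to [y t] has a
    continuous derivative in [s], namely row [i] of [dfdy] against [y t - w t]; integrating over
    [[0, 1]] gives the increment. *)
Lemma avg_jacobianE (R : realType) (d : nat) (f : 'rV[R]_d * R -> 'rV[R]_d)
    (y w : R -> 'rV[R]_d) (t : R) (i : 'I_d) :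
  C1_in_fst f ->
  \sum_j avg_jacobian f y w t i j * (y t - w t) 0 j =
  f (y t, t) 0 i - f (w t, t) 0 i.
Proof.
move=> /(_ t)[df cdf].
pose F z := f (z, t).
pose l s := s *: y t + (1 - s) *: w t.
have lE h s : l (h *: (1 : R) + s) = h *: (y t - w t) + l s.
  by apply/rowP => j; rewrite /l ![_ *: (1 : R)]mulr1 !mxE; ring.
pose g s := \sum_j dfdy f (l s) t i j * (y t - w t) 0 j.
have dg s : is_derive s (1 : R) (fun s => F (l s) 0 i) (g s).
  have -> : g s = ((y t - w t) *m 'J F (l s)) 0 i.
    by rewrite !mxE; apply: eq_bigr => j _; rewrite mxE mulrC.
  apply: is_derive_row_coord; rewrite -deriveEjacobian//.
  (* Since [l] is affine, the difference quotient of [F] along [l] is exactly the directional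
     quotient of [F] at [l s] in the direction [y t - w t]. *)
  have E : (fun h => h^-1 *: (((fun s0 =>
    F (l s0)) \o shift s) (h *: (1 : R)) - F (l s))) =
           (fun h => h^-1 *: ((F \o shift (l s)) (h *: (y t - w t)) - F (l s))).
    by apply/funext => h /=; rewrite lE.
  split; rewrite /derivable /derive E//.
  exact: diff_derivable.
have cl : continuous l.
  move=> s; apply: cvgD; apply: cvgZ; try exact: cvg_cst; first exact: cvg_id.
  by apply: cvgB; [exact: cvg_cst|exact: cvg_id].
have cgj j : continuous (fun s => dfdy f (l s) t i j).
  move=> s.
  have ls : dfdy f (l r) t @[r --> s] --> dfdy f (l s) t.
    by apply: (cvg_comp l (fun z => dfdy f z t) (cl s)); exact: cdf.
  exact: (cvg_comp _ (fun A : 'M[R]_d =>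
    A i j) ls (@coord_continuous _ _ _ i j _)).
have cg : continuous g.
  apply: continuous_big; first exact: add_continuous.
  by move=> j _ s; apply: cvgM; [exact: cgj|exact: cvg_cst].
have igj j : mu.-integrable `[0, 1] (EFin \o (fun s => dfdy f (l s) t i j)).
  apply: continuous_compact_integrable; first exact: segment_compact.
  exact: continuous_subspaceT.
have dF : {in `[0, 1], forall s,
  F (l s) 0 i = F (l 0) 0 i + \int[mu]_(r in `[0, s]) g r}.
  apply: FTC2_indefinite => //.
  - apply: continuous_subspaceT => s.
    apply: differentiable_continuous.
    by apply/derivable1_diffP; case: (dg s).
  - exact: continuous_subspaceT.
have l1 : l 1 = y t by rewrite /l scale1r subrr scale0r addr0.
have l0 : l 0 = w t by rewrite /l scale0r subr0 scale1r add0r.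
have := dF 1; rewrite in_itv/= ler01 lexx l1 l0 => /(_ isT); rewrite /F => ->.
rewrite [RHS]addrC addKr [RHS]Rintegral_sum//; last first.
  move=> j; apply: continuous_compact_integrable; first exact: segment_compact.
  apply: continuous_subspaceT => s.
  by apply: cvgM; [exact: cgj|exact: cvg_cst].
by apply: eq_bigr => j _; rewrite mxE RintegralZr.
Qed.

(** The endpoints form a null set. This suits differential identities, which are available only at
    interior points. *)
Lemma ae_eq_Rintegral_oo (R : realType) (a b : R) (f g : R -> R) :
  mu.-integrable `[a, b] (EFin \o f) -> mu.-integrable `[a, b] (EFin \o g) ->
  {ae mu, forall t : R, t \in `]a, b[ -> f t = g t} ->
  \int[mu]_(t in `[a, b]) f t = \int[mu]_(t in `[a, b]) g t.
Proof.
move=> intf intg fg; rewrite /Rintegral; congr fine.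
have mf : measurable_fun `]a, b[ (EFin \o f).
  apply: (measurable_int mu); apply: integrableS intf => //;
    exact: subset_itv_oo_cc.
have mg : measurable_fun `]a, b[ (EFin \o g).
  apply: (measurable_int mu); apply: integrableS intg => //;
    exact: subset_itv_oo_cc.
rewrite integral_itv_bndoo// [RHS]integral_itv_bndoo//.
apply: ae_eq_integral => //.
move: fg; apply: filterS; first exact: (ae_filter_ringOfSetsType mu).
by move=> t fg tab; rewrite fg.
Qed.

Lemma integrable_sqr (R : realType) (a b : R) (g : R -> R) :
  measurable_fun `[a, b] g ->
  mu.-integrable `[a, b] (fun t => (g t ^+ 2)%:E) ->
  mu.-integrable `[a, b] (EFin \o g).
Proof.
move=> mg ig2.
have i1 : mu.-integrable `[a, b] (EFin \o cst (1 : R)).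
  apply: continuous_compact_integrable; first exact: segment_compact.
  by move=> t; exact: cvg_cst.
have i12 : mu.-integrable `[a, b] ((EFin \o cst 1%R) \+ (fun t =>
  (g t ^+ 2)%:E))%E.
  exact: integrableD.
apply: le_integrable i12 => //; first exact/measurable_EFinP.
move=> t _ /=; rewrite lee_fin [leRHS]ger0_norm ?addr_ge0 ?sqr_ge0//.
(* The square of [|g t| - 1] is nonnegative, so [|g t| <= 2 * |g t| <= 1 + g t ^+ 2]. *)
have := sqr_ge0 (`|g t| - 1); rewrite -[g t ^+ 2]real_normK ?num_real//.
by have := normr_ge0 (g t); nra.
Qed.

(** * Vector-valued functions and their inner products *)

(** Regularity is stated by coordinates, the form in which the scalar integration results apply to
    the sum defining [dotv]. *)
Definition rV_continuous_on (R : realType) (d : nat) (a b : R) (g : R ->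
  'rV[R]_d) :=
  forall i, {within `[a, b], continuous (fun t => g t 0 i)}.

Definition rV_integrable_on (R : realType) (d : nat) (a b : R) (g : R ->
  'rV[R]_d) :=
  forall i, mu.-integrable `[a, b] (EFin \o (fun t => g t 0 i)).

Section inner_product.
Context {R : realType} {d : nat}.
Implicit Types (u v w : 'rV[R]_d) (a b t : R) (g h : R -> 'rV[R]_d).

Lemma dotvC u v : dotv u v = dotv v u.
Proof. by apply: eq_bigr => i _; rewrite mulrC. Qed.

Lemma dotvBl u v w : dotv (u - v) w = dotv u w - dotv v w.
Proof. by rewrite -sumrB; apply: eq_bigr => i _; rewrite !mxE mulrBl. Qed.

Lemma dotvBr u v w : dotv u (v - w) = dotv u v - dotv u w.
Proof. by rewrite dotvC dotvBl !(dotvC u). Qed.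

Lemma dotvNr u v : dotv u (- v) = - dotv u v.
Proof. by rewrite -sumrN; apply: eq_bigr => i _; rewrite mxE mulrN. Qed.

Lemma rV_continuous_onS a b a' b' g : `[a', b'] `<=` `[a, b] ->
  rV_continuous_on a b g -> rV_continuous_on a' b' g.
Proof. by move=> sub cg i; exact: continuous_subspaceW (cg i). Qed.

Lemma rV_integrable_onS a b a' b' g : `[a', b'] `<=` `[a, b] ->
  rV_integrable_on a b g -> rV_integrable_on a' b' g.
Proof. by move=> sub cg i; apply: integrableS (cg i). Qed.

Lemma continuous_rV_continuous_on a b g :
  {within `[a, b], continuous g} -> rV_continuous_on a b g.
Proof.
move=> cg i; apply: (@within_continuous_comp _ _ _ _ g (fun v => v 0 i)) => //.
by move=> v _; exact: coord_continuous.
Qed.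

Lemma rV_continuous_onB a b g h :
  rV_continuous_on a b g -> rV_continuous_on a b h ->
  rV_continuous_on a b (g \- h).
Proof.
move=> cg ch i.
rewrite (_ : (fun _ => _) = (fun t => g t 0 i) - (fun t => h t 0 i)).
  exact: within_continuousB.
by apply/funext => t; rewrite !mxE.
Qed.

Lemma rV_continuous_on_vhorner a b (p : 'rV[{poly R}]_d) :
  rV_continuous_on a b (vhorner p).
Proof.
move=> i; rewrite (_ : (fun _ => _) = horner (p 0 i)).
  by apply: continuous_subspaceT; exact: continuous_horner.
by apply/funext => t; rewrite mxE.
Qed.

Lemma rV_continuous_integrable a b g :
  rV_continuous_on a b g -> rV_integrable_on a b g.
Proof.
move=> cg i; apply: continuous_compact_integrable; first exact: segment_compact.
exact: cg.
Qed.

Lemma integrable_dotv a b g h :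
  rV_continuous_on a b g -> rV_integrable_on a b h ->
  mu.-integrable `[a, b] (EFin \o (fun t => dotv (g t) (h t))).
Proof.
move=> cg ih.
rewrite (_ : _ \o _ = fun t => (\sum_i (g t 0 i * h t 0 i)%:E)%E); last first.
  by apply/funext => t /=; rewrite sumEFin.
by apply: integrable_sum => // i _; exact: integrable_continuousM.
Qed.

Lemma ipBl a b g g' h :
  rV_continuous_on a b g -> rV_continuous_on a b g' -> rV_integrable_on a b h ->
  ip a b (g \- g') h = ip a b g h - ip a b g' h.
Proof.
move=> cg cg' ih; rewrite /ip; under eq_Rintegral do rewrite dotvBl.
by rewrite RintegralB//; exact: integrable_dotv.
Qed.

Lemma ipBr a b g h h' :
  rV_continuous_on a b g -> rV_integrable_on a b h -> rV_integrable_on a b h' ->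
  ip a b g (h \- h') = ip a b g h - ip a b g h'.
Proof.
move=> cg ih ih'; rewrite /ip; under eq_Rintegral do rewrite dotvBr.
by rewrite RintegralB//; exact: integrable_dotv.
Qed.

(** This replaces the derivative of an iterate, whose endpoint values may be junk, by the derivative
    of its polynomial piece. Measurability is inherited from [g']. *)
Lemma eq_ip_oo a b g g' h :
  rV_continuous_on a b g' -> rV_integrable_on a b h ->
  {in `]a, b[, g =1 g'} -> ip a b g h = ip a b g' h.
Proof.
move=> cg' ih gg'; rewrite /ip /Rintegral; congr fine.
have m' : measurable_fun `]a, b[ (fun t => dotv (g' t) (h t)).
  apply/measurable_EFinP; apply: (measurable_int mu).
  by apply: integrableS (integrable_dotv cg' ih) => //; exact: subset_itv_oo_cc.
have E : {in `]a, b[, (fun t => dotv (g t) (h t)) =1 (fun t =>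
  dotv (g' t) (h t))}.
  by move=> t tab /=; rewrite gg'.
apply: eq_integral_itv_bounded => //.
apply: eq_measurable_fun m' => t; rewrite inE /= => tab.
by rewrite E.
Qed.

End inner_product.

(** * Regularity of trajectories, dual solution and polynomial pieces *)

Lemma continuous_along (R : realType) (d : nat) (f : 'rV[R]_d * R -> 'rV[R]_d)
    (A : set R) (w : R -> 'rV[R]_d) :
  continuous f -> {within A, continuous w} -> {within A,
    continuous (along f w)}.
Proof.
move=> cf cw; apply: (@within_continuous_comp _ _ _ _ (fun t => (w t, t)) f).
  by move=> z _; exact: cf.
apply/subspace_continuousP => t At.
apply: (@cvg_pair _ _ _ (within A (nbhs t)) (nbhs (w t)) (nbhs t));
  last exact: cvg_within.
by move/subspace_continuousP : cw; exact.
Qed.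

Lemma abs_continuous_continuous (R : realType) (d : nat) (a b : R)
    (g : R -> 'rV[R]_d) :
  a <= b -> abs_continuous a b g -> rV_continuous_on a b g.
Proof.
move=> ab acg i; have [h ih gE] := acg i.
have ch : {within `[a, b], continuous
    (fun t => g a 0 i + \int[mu]_(s in `[a, t]) h s)}.
  apply: (@within_continuousD _ _ _ _ (fun=> g a 0 i)) => //.
    by move=> t; exact: cvg_cst.
  exact: parameterized_integral_continuous.
apply: subspace_eq_continuous ch => t tab.
by rewrite inE in tab; apply/esym/gE.
Qed.

Lemma indefinite_integral_shift (R : realType) (a b c : R) (u h : R -> R) :
  mu.-integrable `[a, b] (EFin \o h) -> c \in `[a, b] ->
  {in `[a, b], forall t, u t = u a + \int[mu]_(s in `[a, t]) h s} ->
  {in `[c, b], forall t, u t = u c + \int[mu]_(s in `[c, t]) h s}.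
Proof.
move=> ih cab uE t tcb.
move: (cab) (tcb); rewrite !in_itv/= => /andP[ac cb] /andP[ct tb].
have tab : t \in `[a, b] by rewrite in_itv/= (le_trans ac ct).
have iht : mu.-integrable `[a, t] (EFin \o h).
  by apply: integrableS ih => //; apply: subset_itvl; rewrite bnd_simp.
rewrite (uE t tab) (uE c cab) -addrA; congr (_ + _).
rewrite -(@Rintegral_itv_obnd_cbnd _ c); last first.
  by apply: integrableS iht => //; apply: subset_itvr; rewrite bnd_simp.
by rewrite -(Rintegral_itvB iht) ?bnd_simp// subrKC.
Qed.

(** Moving the matrix to the other side of the inner product turns its transpose acting on [v] into
    the matrix acting on [y t - w t], where [avg_jacobianE] applies. *)
Lemma dotv_avg_jacobian (R : realType) (d : nat) (f : 'rV[R]_d * R -> 'rV[R]_d)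
    (y w : R -> 'rV[R]_d) (t : R) (v : 'rV[R]_d) :
  C1_in_fst f ->
  dotv (y t - w t) (v *m avg_jacobian f y w t) =
  dotv (along f y t - along f w t) v.
Proof.
move=> f_C1; transitivity (\sum_k \sum_i
    avg_jacobian f y w t k i * (y t - w t) 0 i * v 0 k).
  rewrite exchange_big; apply: eq_bigr => i _ /=.
  rewrite [(_ *m _) _ _]mxE mulr_sumr; apply: eq_bigr => k _; ring.
apply: eq_bigr => k _; rewrite -mulr_suml avg_jacobianE//.
by rewrite /along !mxE.
Qed.

Lemma is_derive_vhorner (R : realType) (d : nat) (p : 'rV[{poly R}]_d) (t : R) :
  is_derive t (1 : R) (vhorner p) (vhorner (map_mx (@deriv R) p) t).
Proof.
have coordE j : (fun s => vhorner p s 0 j) = horner (p 0 j).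
  by apply/funext => s; rewrite mxE.
have dp : derivable (vhorner p) t 1.
  by apply/derivable_mxP => i j; rewrite ord1 coordE; exact: derivable_horner.
split=> //; apply/rowP => j; rewrite derive_mx// mxE coordE -derive1E -derivE.
by rewrite !mxE.
Qed.

(** * The dual identity on one cell *)

Lemma adjoint_identity_itv (R : realType) (d : nat)
    (f : 'rV[R]_d * R -> 'rV[R]_d) (T : R) (y0 : 'rV[R]_d)
    (y w psi phi : R -> 'rV[R]_d) (psiT : 'rV[R]_d) (a b : R)
    (p : 'rV[{poly R}]_d) :
  continuous f -> C1_in_fst f -> ode_solution f T y0 y ->
  {within `[0, T], continuous w} -> L2_fun 0 T psi ->
  adjoint_solution T (avg_jacobian f y w) psi psiT phi ->
  0 <= a -> a < b -> b <= T -> {in `[a, b], w =1 vhorner p} ->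
  ip a b (y \- w) psi =
  dotv (y a - w a) (phi a) - dotv (y b - w b) (phi b) +
  ip a b (along f w \- vhorner (map_mx (@deriv R) p)) phi.
Proof.
move=> f_cont f_C1 y_sol cw psi_L2 [phi_ac phi_ae _] a0 ab bT wp.
have [cy _ _] := y_sol.
have a0T : a \in `[0, T] by rewrite in_itv/= a0 (le_trans (ltW ab) bT).
have sub : `[a, b] `<=` `[0, T].
  by apply: subset_itv; rewrite bnd_simp.
have suboo : `]a, b[ `<=` `]0, T[.
  by apply: subset_itv; rewrite bnd_simp.
have aab : a \in `[a, b] by rewrite in_itv/= lexx ltW.
have bab : b \in `[a, b] by rewrite in_itv/= lexx ltW.
have T0 : 0 <= T by rewrite (le_trans a0)// (le_trans (ltW ab)).
have cphi : rV_continuous_on a b phi.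
  by apply: rV_continuous_onS sub _; exact: abs_continuous_continuous.
have ipsi : rV_integrable_on a b psi.
  apply: rV_integrable_onS sub _ => i.
  by have [mpsi ipsi2] := psi_L2 i; exact: integrable_sqr.
have cy' : rV_continuous_on a b y.
  by apply: rV_continuous_onS sub _; exact: continuous_rV_continuous_on.
have cw' : rV_continuous_on a b w.
  by apply: rV_continuous_onS sub _; exact: continuous_rV_continuous_on.
have cfy : rV_continuous_on a b (along f y).
  apply: rV_continuous_onS sub _; apply: continuous_rV_continuous_on.
  exact: continuous_along.
have cfw : rV_continuous_on a b (along f w).
  apply: rV_continuous_onS sub _; apply: continuous_rV_continuous_on.
  exact: continuous_along.
pose D := vhorner (map_mx (@deriv R) p).
have cD : rV_continuous_on a b D by exact: rV_continuous_on_vhorner.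
(* [h i] is the density of the absolutely continuous coordinate [i] of [phi]. *)
have /choice[h hP] : forall i, exists h : R -> R,
    mu.-integrable `[0, T] (EFin \o h) /\
    {in `[0, T], forall t, phi t 0 i = phi 0 0 i + \int[mu]_(s in `[0, t]) h s}.
  by move=> i; have [h ? ?] := phi_ac i; exists h.
have ih i : mu.-integrable `[a, b] (EFin \o h i).
  by apply: integrableS (hP i).1.
have phiE i : {in `[a, b], forall t,
    phi t 0 i = phi a 0 i + \int[mu]_(s in `[a, t]) h i s}.
  move=> t tab; have [ihi hE] := hP i.
  apply: (indefinite_integral_shift (u := fun s => phi s 0 i) ihi a0T hE).
  by apply: subset_itvl tab; rewrite bnd_simp.
(* On the cell [z] is the error, but with [p] in place of [w] it is independent of the values of [w]
   outside the cell, and its derivative on []a, b[] extends continuously to [[a, b]]. *)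
pose z := y \- vhorner p.
have cz : rV_continuous_on a b z.
  by apply: rV_continuous_onB => //; exact: rV_continuous_on_vhorner.
have cz' : rV_continuous_on a b (along f y \- D) by exact: rV_continuous_onB.
have zE i : {in `[a, b], forall t,
    z t 0 i = z a 0 i + \int[mu]_(s in `[a, t]) (along f y \- D) s 0 i}.
  apply: (FTC2_indefinite (F := fun t => z t 0 i)) => // t tab.
  apply: is_derive_row_coord; apply: is_deriveB.
    apply: (ode_solution_is_derive y_sol).
    exact: suboo.
  exact: is_derive_vhorner.
have parts i := indefinite_integral_product (ltW ab)
  (rV_continuous_integrable cz' i) (ih i) (zE i) (phiE i).
have izh i : mu.-integrable `[a, b] (EFin \o (fun t => z t 0 i * h i t)).
  exact: integrable_continuousM.
have izphi i : mu.-integrable `[a, b]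
    (EFin \o (fun t => (along f y \- D) t 0 i * phi t 0 i)).
  by apply: integrable_continuousM => //; exact: rV_continuous_integrable.
have iG i : mu.-integrable `[a, b]
    (EFin \o (fun t => z t 0 i * h i t + (along f y \- D) t 0 i * phi t 0 i)).
  exact: integrable_EFinD _ (izh i) (izphi i).
have IG : \int[mu]_(t in `[a, b]) (\sum_i
    (z t 0 i * h i t + (along f y \- D) t 0 i * phi t 0 i)) =
    dotv (z b) (phi b) - dotv (z a) (phi a).
  rewrite Rintegral_sum// -sumrB; apply: eq_bigr => i _.
  by rewrite RintegralD.
have iphi : rV_integrable_on a b phi by exact: rV_continuous_integrable.
have i1 : mu.-integrable `[a, b]
    (EFin \o (fun t => dotv ((along f w \- D) t) (phi t))).
  by apply: integrable_dotv => //; exact: rV_continuous_onB.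
have i2 : mu.-integrable `[a, b]
    (EFin \o (fun t => dotv ((y \- w) t) (psi t))).
  by apply: integrable_dotv => //; exact: rV_continuous_onB.
(* The integrand produced by integration by parts is identified almost everywhere with the one
   containing the residual of [w] and [psi]. *)
have IF : \int[mu]_(t in `[a, b])
    (dotv ((along f w \- D) t) (phi t) - dotv ((y \- w) t) (psi t)) =
    dotv (z b) (phi b) - dotv (z a) (phi a).
  rewrite -IG; apply: ae_eq_Rintegral_oo.
  - exact: integrable_EFinB _ i1 i2.
  - rewrite (_ : _ \o _ = fun t => (\sum_i (z t 0 i * h i t +
      (along f y \- D) t 0 i * phi t 0 i)%:E)%E).
      by apply: integrable_sum => // i _; exact: iG.
    by apply/funext => t /=; rewrite sumEFin.
  (* One exceptional null set serves all coordinates, there being finitely many. *)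
  have phi_ae' : {ae mu, forall t (i : 'I_d), t \in `]0, T[ ->
      is_derive t (1 : R) (fun s => phi s 0 i) (h i t)}.
    apply: filter_forall => i; have [ihi hEi] := hP i.
    exact: (indefinite_integral_ae_derive (u := fun s => phi s 0 i) ihi hEi).
  have F := ae_filter_ringOfSetsType mu.
  move: phi_ae phi_ae'; apply: filterS2 => t + dphi tab.
  have tab' : t \in `[a, b] by apply: subset_itv_oo_cc tab.
  move=> /(_ (sub t tab'))[derphi phiE'].
  (* At almost every [t] the density equals the pointwise derivative, which the adjoint equation
     determines. *)
  have hE : \row_i h i t = - (phi t *m avg_jacobian f y w t + psi t).
    rewrite -phiE' opprK; apply/rowP => i; rewrite mxE derive1E derive_mx// mxE.
    by have [_ ->] := dphi i (suboo t tab).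
  have zt : z t = y t - w t by rewrite /z wp.
  transitivity (dotv (y t - w t) (\row_i h i t) + dotv (along f y t - D t) (phi t)).
    (* The Jacobian term contributes [f(w) - f(y)] against [phi], which turns [f(y) - D] into
       [f(w) - D]. *)
    rewrite hE opprD dotvBr dotvNr dotv_avg_jacobian// !dotvBl; ring.
  rewrite -big_split; apply: eq_bigr => i _.
  by rewrite zt [(\row_i _) _ _]mxE.
rewrite RintegralB// in IF.
have za : z a = y a - w a by rewrite /z wp.
have zb : z b = y b - w b by rewrite /z wp.
move: IF; rewrite za zb => /(canRL (subrK _)) IF.
rewrite /ip -/D IF; ring.
Qed.

(** * Splitting the residual on one cell *)

Lemma derive1_piece (R : realType) (d : nat) (a b : R) (w : R -> 'rV[R]_d)
    (p : 'rV[{poly R}]_d) :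
  {in `[a, b], w =1 vhorner p} ->
  {in `]a, b[, derive1 w =1 vhorner (map_mx (@deriv R) p)}.
Proof.
move=> wp t tab; rewrite derive1E (@near_eq_derive _ _ _ w (vhorner p)).
  by have [_ ->] := is_derive_vhorner p t.
have := near_in_itvoo tab; apply: filterS => s sab.
by apply: wp; exact: subset_itv_oo_cc sab.
Qed.

Lemma qipBl (R : realType) (d : nat) (Q : quad_rule) (a b : R)
    (g h v : R -> 'rV[R]_d) :
  qip Q a b (g \- h) v = qip Q a b g v - qip Q a b h v.
Proof. by rewrite /qip dotvBl mulrBr. Qed.

Lemma qipBr (R : realType) (d : nat) (Q : quad_rule) (a b : R)
    (g v v' : R -> 'rV[R]_d) :
  qip Q a b g (v \- v') = qip Q a b g v - qip Q a b g v'.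
Proof. by rewrite /qip dotvBr mulrBr. Qed.

(* S = S_n f^{K-1}, S' = S_n f^K, F = f(Y^K, .), G = f(Y^{K-1}, .), W' is the
   derivative of Y^K, D its polynomial representative on the cell, v = pi phi. *)
Lemma error_terms_cell (R : realType) (d : nat) (Q : quad_rule) (a b : R)
    (S S' D W' F G phi v : R -> 'rV[R]_d) :
  rV_continuous_on a b S -> rV_continuous_on a b S' ->
  rV_continuous_on a b D -> rV_continuous_on a b F ->
  rV_continuous_on a b phi -> rV_continuous_on a b v ->
  {in `]a, b[, W' =1 D} ->
  ip a b W' v = qip Q a b (F \- G) v + ip a b S v ->
  ip a b (S \- W') (phi \- v) + qip Q a b (F \- G) (phi \- v)
  + ip a b (F \- S') phi + (qip Q a b (G \- F) phi + ip a b (S' \- S) phi) =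
  ip a b (F \- D) phi.
Proof.
move=> cS cS' cD cF cphi cv WD.
have iphi := rV_continuous_integrable cphi.
have iv := rV_continuous_integrable cv.
have iphiv := rV_continuous_integrable (rV_continuous_onB cphi cv).
have SWD : {in `]a, b[, S \- W' =1 S \- D} by move=> t tab /=; rewrite WD.
rewrite (eq_ip_oo cD iv WD) (eq_ip_oo (rV_continuous_onB cS cD) iphiv SWD).
(* After expansion, the terms against [phi] collapse to [F - D], and those against [v] add up to the
   SDC equation tested with [v], hence to zero. *)
rewrite !qipBr !qipBl !ipBl// !ipBr// => E.
have -> : ip a b D v = qip Q a b F v - qip Q a b G v + ip a b S v by [].
ring.
Qed.

(** * Summation over the grid *)

Lemma le_chain (R : realType) (s : nat -> R) (k : nat) :
  (forall i, (i < k)%N -> s i < s i.+1) ->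
  forall i j, (i <= j <= k)%N -> s i <= s j.
Proof.
move=> sS i j /andP[]; elim: j => [|j IH].
  by rewrite leqn0 => /eqP->.
rewrite leq_eqVlt => /predU1P[->//|ij jk].
by rewrite (le_trans (IH ij (ltnW jk)))// ltW// sS.
Qed.

Lemma Rintegral_chain (R : realType) (u : R -> R) (s : nat -> R) (k : nat) :
  (forall i, (i < k)%N -> s i < s i.+1) ->
  mu.-integrable `[s 0%N, s k] (EFin \o u) ->
  \int[mu]_(t in `[s 0%N, s k]) u t =
  \sum_(0 <= i < k) \int[mu]_(t in `[s i, s i.+1]) u t.
Proof.
move=> sS; elim: k sS => [|k IH] sS iu.
  by rewrite big_nil set_itv1 Rintegral_set1.
have s0k : s 0%N <= s k by apply: (le_chain sS); rewrite /=.
have skk : s k <= s k.+1 by rewrite ltW// sS.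
have iuk : mu.-integrable `[s 0%N, s k] (EFin \o u).
  by apply: integrableS iu => //; apply: subset_itvl; rewrite bnd_simp.
rewrite big_nat_recr//= -IH//; last by move=> i ik; apply: sS; exact: ltnW.
rewrite -(@Rintegral_itv_obnd_cbnd _ (s k)).
  by rewrite -(Rintegral_itvB iu) ?bnd_simp// subrKC.
by apply: integrableS iu => //; apply: subset_itvr; rewrite bnd_simp.
Qed.

Theorem theorem4 (R : realType) (d : nat)
  (f : 'rV[R]_d * R -> 'rV[R]_d) (T : R) (y0 : 'rV[R]_d) (y : R -> 'rV[R]_d)
  (N M q K : nat) (t : nat -> R) (tau : nat -> nat -> R) (Q : quad_rule)
  (Y : nat -> R -> 'rV[R]_d)
  (psi : R -> 'rV[R]_d) (psiT : 'rV[R]_d) (phi : R -> 'rV[R]_d)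
  (x : nat -> nat -> nat -> R)
  (f_cont : continuous f)
  (f_C1 : C1_in_fst f)
  (T_gt0 : 0 < T)
  (y_sol : ode_solution f T y0 y)
  (t_grid : grid T N t)
  (tau_grid : gauss_lobatto_subgrid N M t tau)
  (q_ge1 : (1 <= q)%N)
  (K_ge1 : (1 <= K)%N)
  (Y_fe : forall k, (k <= K)%N -> fe_space T N M q tau (Y k))
  (Y_step : forall k, (k < K)%N -> sdc_step N M q tau Q f y0 (Y k) (Y k.+1))
  (psi_L2 : L2_fun 0 T psi)
  (phi_sol : adjoint_solution T (avg_jacobian f y (Y K)) psi psiT phi)
  (x_nodes : projection_nodes N M q tau x) :
  let e := y \- Y K in
  let S n k := sdc_interp M tau f n (Y k) in
  let F k := along f (Y k) in
  let proj n m := interp q (x n m) phi in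
  let E_D := \sum_(0 <= n < N) \sum_(0 <= m < M)
    (ip (tau n m) (tau n m.+1) (S n K.-1 \- derive1 (Y K)) (phi \- proj n m)
     + qip Q (tau n m) (tau n m.+1) (F K \- F K.-1) (phi \- proj n m)) in
  let E_M := \sum_(0 <= n < N) \sum_(0 <= m < M)
    ip (tau n m) (tau n m.+1) (F K \- S n K) phi in
  let E_K := \sum_(0 <= n < N) \sum_(0 <= m < M)
    (qip Q (tau n m) (tau n m.+1) (F K.-1 \- F K) phi
     + ip (tau n m) (tau n m.+1) (S n K \- S n K.-1) phi) in
  ip 0 T e psi + dotv (e T) psiT = E_D + E_M + E_K.
Proof.
move=> e S F proj E_D E_M E_K.
have [t0 tN t_lt] := t_grid.
have [cYK pYK] := Y_fe K (leqnn K).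
have [phi_ac _ phiT] := phi_sol.
have [cy y_0 _] := y_sol.
(* As [K] is positive, [K.-1] is a genuine predecessor and the last SDC step leads from [Y K.-1] to
   [Y K]. *)
have Kp : (K.-1 < K)%N by rewrite prednK.
have [YK0 stepK] := Y_step K.-1 Kp.
rewrite (prednK K_ge1) in YK0 stepK.
have tau_in n m : (n < N)%N -> (m < M)%N -> 
    [/\ 0 <= tau n m, tau n m < tau n m.+1 & tau n m.+1 <= T].
  move=> nN mM; have [tau0 tauM tau_lt _] := tau_grid n nN.
  split; last 1 first.
  - apply: (@le_trans _ _ (t n.+1)).
      by rewrite -tauM; apply: (le_chain tau_lt); rewrite mM leqnn.
    by rewrite -tN; apply: (le_chain t_lt); rewrite nN leqnn.
  - apply: (@le_trans _ _ (t n)).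
      by rewrite -t0; apply: (le_chain t_lt); rewrite /= ltnW.
    by rewrite -tau0; apply: (le_chain tau_lt); rewrite /= ltnW.
  - exact: tau_lt.
(* The boundary term of the integration by parts, whose cell increments telescope. *)
pose g s := dotv (e s) (phi s).
have cell n m : (n < N)%N -> (m < M)%N ->
  ip (tau n m) (tau n m.+1) (S n K.-1 \- derive1 (Y K)) (phi \- proj n m)
     + qip Q (tau n m) (tau n m.+1) (F K \- F K.-1) (phi \- proj n m)
  + ip (tau n m) (tau n m.+1) (F K \- S n K) phi
  + (qip Q (tau n m) (tau n m.+1) (F K.-1 \- F K) phi
     + ip (tau n m) (tau n m.+1) (S n K \- S n K.-1) phi) =
  ip (tau n m) (tau n m.+1) e psi + (g (tau n m.+1) - g (tau n m)).
  move=> nN mM; have [a0 ab bT] := tau_in n m nN mM.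
  have sub : `[tau n m, tau n m.+1] `<=` `[0, T] by apply: subset_itv;
    rewrite bnd_simp.
  have [p _ YKp] := pYK n m nN mM.
  rewrite (error_terms_cell (D := vhorner (map_mx (@deriv R) p))).
  - rewrite (adjoint_identity_itv f_cont f_C1 y_sol cYK psi_L2 phi_sol a0 ab bT YKp).
    rewrite /g /e; ring.
  - exact: rV_continuous_on_vhorner.
  - exact: rV_continuous_on_vhorner.
  - exact: rV_continuous_on_vhorner.
  - apply: rV_continuous_onS sub _; apply: continuous_rV_continuous_on.
    exact: continuous_along.
  - by apply: rV_continuous_onS sub _; apply: abs_continuous_continuous => //;
      exact: ltW.
  - exact: rV_continuous_on_vhorner.
  - exact: derive1_piece.
  (* The nodal projection of [phi] is an admissible test function: interpolation at [q] nodes gives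
     polynomials of size at most [q], that is, of degree at most [q - 1]. *)
  - by apply: stepK => //; exact: size_interp_poly.
have iepsi : mu.-integrable `[0, T] (EFin \o (fun s => dotv (e s) (psi s))).
  apply: integrable_dotv.
    by apply: rV_continuous_onB; exact: continuous_rV_continuous_on.
  by move=> i; have [mpsi ipsi2] := psi_L2 i; exact: integrable_sqr.
(* The interval is cut twice, first at the grid points and then, inside each [[t n, t n.+1]], at the
   subnodes. *)
have ipE : ip 0 T e psi = \sum_(0 <= n < N) \sum_(0 <= m < M)
    ip (tau n m) (tau n m.+1) e psi.
  transitivity (\int[mu]_(s in `[t 0%N, t N]) dotv (e s) (psi s)).
    by rewrite t0 tN.
  rewrite Rintegral_chain//; last by rewrite t0 tN.
  apply: eq_big_nat => n /andP[_ nN].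
  have [tau0 tauM tau_lt _] := tau_grid n nN.
  rewrite -tau0 -tauM Rintegral_chain// tau0 tauM.
  apply: integrableS iepsi => //; apply: subset_itv; rewrite bnd_simp.
    by rewrite -t0; apply: (le_chain t_lt); rewrite /= ltnW.
  by rewrite -tN; apply: (le_chain t_lt); rewrite nN leqnn.
have gE : \sum_(0 <= n < N) \sum_(0 <= m < M) (g (tau n m.+1) - g (tau n m)) =
    dotv (e T) psiT.
  transitivity (\sum_(0 <= n < N) (g (t n.+1) - g (t n))).
    apply: eq_big_nat => n /andP[_ nN].
    have [tau0 tauM _ _] := tau_grid n nN.
    by rewrite telescope_sumr// tau0 tauM.
  (* The exact solution and the last iterate both start at [y0], so only the boundary term at [T]
     survives, where [phi T = psiT]. *)
  have e0 : e 0 = 0 by rewrite /e /= y_0 YK0 subrr.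
  rewrite telescope_sumr// t0 tN /g phiT e0.
  by rewrite [X in _ - X]big1 ?subr0// => i _; rewrite mxE mul0r.
rewrite ipE -gE /E_D /E_M /E_K -!big_split;
  apply: eq_big_nat => n /andP[_ nN] /=.
rewrite -!big_split; apply: eq_big_nat => m /andP[_ mM] /=.
by rewrite cell.
Qed.
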